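(* Let $\mathbb{Q}$ be the field of rational numbers with the discrete topology, and let $a_2,a_3,b_2,b_3$ be nonzero rational numbers. Let $\xi_1,\xi_2,\xi_3,\xi_4$ be independent $\mathbb{Q}$-valued random variables with nowhere-vanishing characteristic functions, and put $L_1=\xi_1+a_2\xi_2+a_3\xi_3$, $L_2=b_2\xi_2+b_3\xi_3+\xi_4$. For independent $\mathbb{Q}$-valued random variables $\eta_1,\dots,\eta_4$ with nowhere-vanishing characteristic functions put $M_1=\eta_1+a_2\eta_2+a_3\eta_3$, $M_2=b_2\eta_2+b_3\eta_3+\eta_4$. (I) If $a_2b_3\neq a_3b_2$, then for every such $\eta_1,\dots,\eta_4$ with $(M_1,M_2)$ equal in distribution to $(L_1,L_2)$, there exist $\alpha_1,\dots,\alpha_4\in\mathbb{Q}$ such that $\eta_j$ has the same distribution as $\xi_j+\alpha_j$ for $j=1,\dots,4$. (II)/(III) If $a_2b_3=a_3b_2$, $\xi_2$ and $\xi_3$ are identically distributed, and either $|a_2|\neq|a_3|$ or $a_2=a_3$, then for every such $\eta_1,\dots,\eta_4$ with $\eta_2,\eta_3$ identically distributed and $(M_1,M_2)$ equal in distribution to $(L_1,L_2)$, there exist $\alpha_1,\dots,\alpha_4\in\mathbb{Q}$ such that $\eta_j$ has the same distribution as $\xi_j+\alpha_j$ for $j=1,\dots,4$.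
   Context: The character group of the discrete additive group $\mathbb{Q}$ is the compact $\boldsymbol a$-adic solenoid $\Sigma_{\boldsymbol a}$ with $\boldsymbol a=(2,3,4,\dots)$; write $(x,y)$ for the value of the character $y\in\Sigma_{\boldsymbol a}$ at $x\in\mathbb{Q}$. The characteristic function of a $\mathbb{Q}$-valued random variable $\xi$ is $y\mapsto\mathbf{E}[(\xi,y)]$, $y\in\Sigma_{\boldsymbol a}$; ''nowhere-vanishing'' means it is nonzero at every $y\in\Sigma_{\boldsymbol a}$. *)

(* Defs.v *)
From HB Require Import structures.
From mathcomp Require Import all_boot all_order all_algebra.
From mathcomp Require Import all_classical all_reals all_analysis.
Set Implicit Arguments.
Unset Strict Implicit.
Unset Printing Implicit Defensive.
Import Order.TTheory GRing.Theory Num.Theory.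
Local Open Scope classical_set_scope.
Local Open Scope ring_scope.

(* Q carries the discrete topology, hence the discrete sigma-algebra: a
   Q-valued random variable on (T, P) is a map X : T -> rat all of whose
   preimages are measurable. *)
Definition rat_rv d (T : measurableType d) (X : T -> rat) : Prop :=
  forall A : set rat, measurable (X @^-1` A).

(* Mutual independence of four Q-valued random variables: the product rule
   for all events {X_i \in A_i} (sub-families follow by taking A_i = setT). *)
Definition indep4 d (T : measurableType d) (R : realType)
  (P : probability T R) (X1 X2 X3 X4 : T -> rat) : Prop :=
  forall A1 A2 A3 A4 : set rat,
    P (X1 @^-1` A1 `&` X2 @^-1` A2 `&` X3 @^-1` A3 `&` X4 @^-1` A4)
    = (P (X1 @^-1` A1) * P (X2 @^-1` A2) * P (X3 @^-1` A3) * P (X4 @^-1` A4))%E.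

Definition same_law d (T : measurableType d) d' (T' : measurableType d')
  (R : realType) (P : probability T R) (X : T -> rat)
  (P' : probability T' R) (Y : T' -> rat) : Prop :=
  forall A : set rat, P (X @^-1` A) = P' (Y @^-1` A).

(* (X1,X2) and (Y1,Y2) have the same joint distribution on Q x Q
   (rectangles generate the discrete sigma-algebra of Q x Q and form a
   pi-system, so this is equality in distribution). *)
Definition same_law2 d (T : measurableType d) d' (T' : measurableType d')
  (R : realType) (P : probability T R) (X1 X2 : T -> rat)
  (P' : probability T' R) (Y1 Y2 : T' -> rat) : Prop :=
  forall A1 A2 : set rat,
    P (X1 @^-1` A1 `&` X2 @^-1` A2) = P' (Y1 @^-1` A1 `&` Y2 @^-1` A2).

(* A character y of the discrete group (Q,+), i.e. an element of its dual
   group Sigma_a, given by its value (x,y) = c x + i s x in the unit circle: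
   a homomorphism Q -> T (written in real and imaginary parts). *)
Definition is_character (R : realType) (c s : rat -> R) : Prop :=
  (forall x, c x ^+ 2 + s x ^+ 2 = 1) /\
  (forall x y, c (x + y) = c x * c y - s x * s y) /\
  (forall x y, s (x + y) = s x * c y + c x * s y).

(* The characteristic function y |-> E[(X,y)] = E[c X] + i E[s X] is
   nowhere vanishing on the character group. *)
Definition charfun_nonvanishing d (T : measurableType d) (R : realType)
  (P : probability T R) (X : T -> rat) : Prop :=
  forall c s : rat -> R, is_character c s ->
    ~ (((\int[P]_w (c (X w))%:E)%E = 0%E) /\ ((\int[P]_w (s (X w))%:E)%E = 0%E)).

(* Main.v *)
(**
  Only the restrictions of the characteristic functions to the one-parameter
  subgroup of the solenoid formed by the characters [x |-> exp(2 pi i t x)],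
  [t] real, are needed.  The ratios [h_j] of the characteristic
  functions of [eta_j] and [xi_j] satisfy
  [h_1(u) h_2(a_2 u + b_2 v) h_3(a_3 u + b_3 v) h_4(v) = 1].

  If [a_2 b_3 <> a_3 b_2], taking differences along the kernels of three of the
  four forms shows that the third difference of each [h_j] is trivial.  Its
  second difference [B] is then a positive bicharacter.  Since [n! X] is
  eventually an integer for rational [X], translation by [n!] asymptotically
  fixes characteristic functions, so [B(x, 1)^(n!)] tends to [1] and [B = 1].

  If [a_2 b_3 = a_3 b_2], then with [lam = a_3 / a_2] the product
  [h_2(t) h_2(lam t)] is a homomorphism, as are [h_1] and [h_4], and continuity
  of [h_2] forces [h_2] to be a homomorphism: by contraction towards [0] if
  [|lam| <> 1], and because [h_2] has no continuous sign ambiguity on the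
  connected line if [lam = 1].

  A homomorphic ratio [h] comes from a shift: Fejer type kernels on the dual of
  [rat] compute [P(Y = y)] as the probability that the random character
  [q |-> h(q) exp(2 pi i q (X - y))] is trivial; an atom [y] of [Y] then gives
  [h(q) = exp(2 pi i q al)] with [al] rational.
*)
Require Import Defs.
From HB Require Import structures.
From mathcomp Require Import all_boot all_order all_algebra.
From mathcomp Require Import complex ring lra.
From mathcomp Require Import all_classical all_reals all_analysis.
From mathcomp Require Import measurable_realfun.
Set Implicit Arguments.
Unset Strict Implicit.
Unset Printing Implicit Defensive.
Import Order.TTheory GRing.Theory Num.Theory numFieldNormedType.Exports.
Local Open Scope classical_set_scope.
Local Open Scope ring_scope.
Local Open Scope complex_scope.

Local Notation Re := complex.Re.
Local Notation Im := complex.Im.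

(** * Bounded random variables and expectation *)

(** Unlike integrability, this predicate is stable under products, and under a probability measure
    it implies integrability. *)
Definition bmf d (T : measurableType d) (R : realType) (f : T -> R) : Prop :=
  measurable_fun setT f /\ exists M, forall w, `|f w| <= M.

Section BoundedMeasurable.
Context d (T : measurableType d) (R : realType) (P : probability T R).
Implicit Types f g : T -> R.

Lemma bmf_integrable f : bmf f -> P.-integrable setT (EFin \o f).
Proof.
move=> [mf [M fM]]; apply: measurable_bounded_integrable => //.
  by rewrite -ge0_fin_numE // fin_num_measure.
exists M; split; first by rewrite num_real.
by move=> x Mx w _ /=; exact: le_trans (fM w) (ltW Mx).
Qed.

Lemma bmf_cst (k : R) : bmf (fun _ : T => k).
Proof. by split; [exact: measurable_cst | exists `|k|]. Qed.

Lemma bmfD f g : bmf f -> bmf g -> bmf (fun w => f w + g w).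
Proof.
move=> [mf [M fM]] [mg [N gN]]; split; first exact: measurable_funD.
by exists (M + N) => w; apply: le_trans (ler_normD _ _) (lerD (fM w) (gN w)).
Qed.

Lemma bmfM f g : bmf f -> bmf g -> bmf (fun w => f w * g w).
Proof.
move=> [mf [M fM]] [mg [N gN]]; split; first exact: measurable_funM.
by exists (M * N) => w; rewrite normrM ler_pM.
Qed.

Lemma bmfN f : bmf f -> bmf (fun w => - f w).
Proof.
move=> bf; have := bmfM (bmf_cst (-1)) bf.
by under eq_fun do rewrite mulN1r.
Qed.

Lemma bmf_rv (X : T -> rat) (phi : rat -> R) : rat_rv X ->
  (exists M, forall x, `|phi x| <= M) -> bmf (fun w => phi (X w)).
Proof.
move=> mX [M phiM]; split; last by exists M => w.
by move=> _ B _; rewrite setTI; exact: (mX (phi @^-1` B)).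
Qed.

Lemma meanD f g : bmf f -> bmf g ->
  \int[P]_w (f w + g w) = \int[P]_w f w + \int[P]_w g w.
Proof. by move=> bf bg; rewrite RintegralD//; exact: bmf_integrable. Qed.

Lemma meanZ (k : R) f : bmf f -> \int[P]_w (k * f w) = k * \int[P]_w f w.
Proof. by move=> bf; rewrite RintegralZl//; exact: bmf_integrable. Qed.

Lemma mean_cst (k : R) : \int[P]_w k = k.
Proof.
rewrite Rintegral_cst// -[RHS]mulr1; congr (_ * _).
exact: (congr1 fine (probability_setT P)).
Qed.

Lemma meanN f : bmf f -> \int[P]_w (- f w) = - \int[P]_w f w.
Proof.
by move=> bf; under eq_fun do rewrite -mulN1r; rewrite meanZ// mulN1r.
Qed.

(** Dominated convergence with the constant [M] as dominating function, integrable because [P] has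
    mass one; the limit inherits the bound [M]. *)
Lemma bounded_convergence (f_ : nat -> T -> R) f (M : R) :
  (forall n, measurable_fun setT (f_ n)) -> (forall n w, `|f_ n w| <= M) ->
  (forall w, f_ ^~ w @ \oo --> f w) ->
  bmf f /\ (fun n => \int[P]_w f_ n w) @ \oo --> \int[P]_w f w.
Proof.
move=> mf_ f_M f_f.
have mf : measurable_fun setT f.
  by apply: (measurable_fun_cvg (h := f_)) => // w _; exact: f_f.
have fM w : `|f w| <= M.
  have cf : (fun n => `|f_ n w|) @ \oo --> `|f w| by exact: cvg_norm (f_f w).
  rewrite -(cvg_lim _ cf)//.
  by apply: limr_le; [apply/cvg_ex; exists `|f w| | apply: nearW].
have bf : bmf f by split=> //; exists M.
split=> //.
have mE (g : T -> R) : measurable_fun setT g -> measurable_fun setT (EFin \o g).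
  by move=> mg; apply/measurable_EFinP.
have cE w : (fun n => (f_ n w)%:E) @ \oo --> (f w)%:E.
  by apply: cvg_EFin; [exact: nearW | exact: f_f].
have [_ _ dc] := @dominated_convergence _ _ _ P setT measurableT
  (fun n w => (f_ n w)%:E) (EFin \o f) (cst M%:E)
  (fun n => mE _ (mf_ n)) (mE _ mf)
  (aeW _ (fun w _ => cE w))
  (bmf_integrable (bmf_cst M))
  (aeW _ (fun w n _ => f_M n w)).
apply: fine_cvg; rewrite /Rintegral fineK//.
exact: integrable_fin_num (bmf_integrable bf).
Qed.

End BoundedMeasurable.

(** * Complex-valued expectation, taken componentwise *)

Lemma Re_mul (R : realType) (x y : R[i]) : Re (x * y) = Re x * Re y - Im x * Im y.
Proof. by case: x y => [a b] [c s]. Qed.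

Lemma Im_mul (R : realType) (x y : R[i]) : Im (x * y) = Re x * Im y + Im x * Re y.
Proof. by case: x y => [a b] [c s] /=; rewrite [b * c]mulrC. Qed.

Lemma Re_add (R : realType) (x y : R[i]) : Re (x + y) = Re x + Re y.
Proof. by case: x y => [a b] [c s]. Qed.

Lemma Im_add (R : realType) (x y : R[i]) : Im (x + y) = Im x + Im y.
Proof. by case: x y => [a b] [c s]. Qed.

Lemma complex_ext (R : realType) (x y : R[i]) : Re x = Re y -> Im x = Im y -> x = y.
Proof. by case: x y => [a b] [c s] /= -> ->. Qed.

Definition boundedC (R : realType) (phi : rat -> R[i]) : Prop :=
  exists M, forall x, `|Re (phi x)| <= M /\ `|Im (phi x)| <= M.

Definition bmc d (T : measurableType d) (R : realType) (f : T -> R[i]) : Prop :=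
  bmf (fun w => Re (f w)) /\ bmf (fun w => Im (f w)).

Definition expC d (T : measurableType d) (R : realType) (P : probability T R)
  (f : T -> R[i]) : R[i] := (\int[P]_w Re (f w)) +i* (\int[P]_w Im (f w)).

Section ComplexExpectation.
Context d (T : measurableType d) (R : realType) (P : probability T R).
Implicit Types f g : T -> R[i].

Lemma bmc_cst (k : R[i]) : bmc (fun _ : T => k).
Proof. by split; exact: bmf_cst. Qed.

Lemma bmcM f g : bmc f -> bmc g -> bmc (fun w => f w * g w).
Proof.
move=> [rf jf] [rg jg]; split.
  by under eq_fun do rewrite Re_mul; apply: bmfD; [|apply: bmfN]; exact: bmfM.
by under eq_fun do rewrite Im_mul; apply: bmfD; exact: bmfM.
Qed.

Lemma bmc_rv (X : T -> rat) (phi : rat -> R[i]) : rat_rv X ->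
  boundedC phi ->
  bmc (fun w => phi (X w)).
Proof.
move=> mX [M phiM]; split.
  by apply: (bmf_rv mX (phi := fun x => Re (phi x))); exists M => x; case: (phiM x).
by apply: (bmf_rv mX (phi := fun x => Im (phi x))); exists M => x; case: (phiM x).
Qed.

Lemma bmc_eq (X : T -> rat) (a : rat) : rat_rv X ->
  bmc (fun w => (X w == a)%:R : R[i]).
Proof.
move=> mX; apply: (bmc_rv mX (phi := fun x => (x == a)%:R)); exists 1 => x.
by case: (x == a); rewrite /= ?normr1 ?normr0.
Qed.

Lemma expC_cst (k : R[i]) : expC P (fun=> k) = k.
Proof. by rewrite /expC !mean_cst; case: k. Qed.

Lemma expCD f g : bmc f -> bmc g ->
  expC P (fun w => f w + g w) = expC P f + expC P g.
Proof.
move=> [rf jf] [rg jg]; apply: complex_ext; rewrite ?Re_add ?Im_add /=.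
  by under eq_fun do rewrite Re_add; rewrite meanD.
by under eq_fun do rewrite Im_add; rewrite meanD.
Qed.

Lemma expCZ (k : R[i]) f : bmc f -> expC P (fun w => k * f w) = k * expC P f.
Proof.
move=> [rf jf]; apply: complex_ext; rewrite ?Re_mul ?Im_mul /=.
  under eq_fun do rewrite Re_mul -mulNr.
  by rewrite meanD ?meanZ ?mulNr//; apply: bmfM => //; exact: bmf_cst.
under eq_fun do rewrite Im_mul.
by rewrite meanD ?meanZ//; apply: bmfM => //; exact: bmf_cst.
Qed.

(** Convergence is assumed in the strong form that each sample point sees an eventually constant
    sequence; truncations of functions on [rat] and translations by factorials both have this
    property. *)
Lemma expC_cvg (f_ : nat -> T -> R[i]) f (M : R) :
  (forall n, bmc (f_ n)) ->
  (forall n w, `|Re (f_ n w)| <= M /\ `|Im (f_ n w)| <= M) ->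
  (forall w, exists N, forall n, (N <= n)%N -> f_ n w = f w) ->
  (fun n => Re (expC P (f_ n))) @ \oo --> Re (expC P f) /\
  (fun n => Im (expC P (f_ n))) @ \oo --> Im (expC P f).
Proof.
move=> bf_ f_M f_f; split.
  apply: (proj2 (@bounded_convergence _ _ _ P (fun n w => Re (f_ n w))
    (fun w => Re (f w)) M _ _ _)) => [n|n w|w].
  - by case: (bf_ n) => -[].
  - by case: (f_M n w).
  - have [N fN] := f_f w; apply: cvg_near_cst; exists N => // n /= Nn.
    by rewrite fN.
apply: (proj2 (@bounded_convergence _ _ _ P (fun n w => Im (f_ n w))
    (fun w => Im (f w)) M _ _ _)) => [n|n w|w].
- by case: (bf_ n) => _ [].
- by case: (f_M n w).
- have [N fN] := f_f w; apply: cvg_near_cst; exists N => // n /= Nn.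
  by rewrite fN.
Qed.

End ComplexExpectation.

(** * From atoms to bounded functions *)

Section Transfer.
Context d (T : measurableType d) d' (T' : measurableType d') (R : realType).
Variables (P : probability T R) (P' : probability T' R).
Variables (X : T -> rat) (Y : T' -> rat).
Hypotheses (mX : rat_rv X) (mY : rat_rv Y).

(** A function on [rat] is the limit of its truncations along the enumeration [pickle], and each
    truncation is a finite combination of indicators of atoms. The weights [F] and [G] carry the
    remaining variables, so that several variables can be treated one at a time. *)
Lemma expC_transfer (F : T -> R[i]) (G : T' -> R[i]) (phi : rat -> R[i]) :
  bmc F -> bmc G ->
  boundedC phi ->
  (forall a, expC P (fun w => F w * (X w == a)%:R) =
             expC P' (fun w => G w * (Y w == a)%:R)) ->
  expC P (fun w => F w * phi (X w)) = expC P' (fun w => G w * phi (Y w)).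
Proof.
move=> bF bG [M phiM] FG.
pose phin n x : R[i] := if (pickle x < n)%N then phi x else 0.
have phinM n x : `|Re (phin n x)| <= M /\ `|Im (phin n x)| <= M.
  rewrite /phin; case: ifP => // _ /=; rewrite normr0.
  by case: (phiM x) => /(le_trans (normr_ge0 _)).
(* Raising the truncation level from [n] to [n.+1] adds the atom with code [n], if a rational has
   that code. *)
have phinE n x a : pickle_inv n = Some a -> phin n.+1 x = phin n x + phi a * (x == a)%:R.
  move=> na; have an : pickle a = n by have := @pickle_invK rat n; rewrite na.
  rewrite /phin ltnS leq_eqVlt; have [xn|xn] := eqVneq (pickle x) n.
    have -> : x = a by apply: (pcan_inj pickleK); rewrite an.
    by rewrite an ltnn eqxx mulr1 add0r.
  have [xa|_] := eqVneq x a; first by rewrite xa an eqxx in xn.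
  by rewrite mulr0 addr0.
have phinE0 n x : pickle_inv n = None :> option rat -> phin n.+1 x = phin n x.
  move=> nN; rewrite /phin ltnS leq_eqVlt; have [xn|//] := eqVneq (pickle x) n.
  by move: nN; rewrite -xn pickleK_inv.
have bX n : bmc (fun w => phin n (X w)) by apply: (bmc_rv mX); exists M.
have bY n : bmc (fun w => phin n (Y w)) by apply: (bmc_rv mY); exists M.
have FGn n : expC P (fun w => F w * phin n (X w)) =
             expC P' (fun w => G w * phin n (Y w)).
  elim: n => [|n IHn].
    under eq_fun do rewrite /phin/= mulr0.
    by under [in RHS]eq_fun do rewrite /phin/= mulr0; rewrite !expC_cst.
  case na : (pickle_inv n : option rat) => [a|]; last first.
    under eq_fun do rewrite phinE0//.
    by under [in RHS]eq_fun do rewrite phinE0//.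
  under eq_fun do rewrite (phinE _ _ _ na) mulrDr mulrCA.
  under [in RHS]eq_fun do rewrite (phinE _ _ _ na) mulrDr mulrCA.
  have bXa := bmcM bF (bmc_eq R a mX); have bYa := bmcM bG (bmc_eq R a mY).
  rewrite (expCD P (bmcM bF (bX n)) (bmcM (bmc_cst T (phi a)) bXa)).
  rewrite (expCD P' (bmcM bG (bY n)) (bmcM (bmc_cst T' (phi a)) bYa)).
  by rewrite !expCZ// IHn FG.
have [MF [rF jF]] : exists M',
    (forall w, `|Re (F w)| <= M') /\ (forall w, `|Im (F w)| <= M').
  case: bF => -[_ [A FA]] [_ [B FB]]; exists (Num.max A B).
  by split=> w; rewrite le_max ?FA ?FB ?orbT.
have [MG [rG jG]] : exists M',
    (forall w, `|Re (G w)| <= M') /\ (forall w, `|Im (G w)| <= M').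
  case: bG => -[_ [A FA]] [_ [B FB]]; exists (Num.max A B).
  by split=> w; rewrite le_max ?FA ?FB ?orbT.
have prodM (z u : R[i]) K : `|Re z| <= K -> `|Im z| <= K -> `|Re u| <= M ->
    `|Im u| <= M -> `|Re (z * u)| <= K * M + K * M /\ `|Im (z * u)| <= K * M + K * M.
  move=> rz jz ru ju; rewrite Re_mul Im_mul; split.
    by apply: le_trans (ler_normB _ _) _; rewrite !normrM lerD ?ler_pM.
  by apply: le_trans (ler_normD _ _) _; rewrite !normrM lerD ?ler_pM.
have ev S (Z : S -> rat) (H : S -> R[i]) w :
    exists N, forall n, (N <= n)%N -> H w * phin n (Z w) = H w * phi (Z w).
  by exists (pickle (Z w)).+1 => n Nn; rewrite /phin Nn.
have [cR cI] := expC_cvg P (fun n => bmcM bF (bX n))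
  (fun n w => prodM _ _ _ (rF w) (jF w) (phinM n (X w)).1 (phinM n (X w)).2) (ev _ X F).
have [cR' cI'] := expC_cvg P' (fun n => bmcM bG (bY n))
  (fun n w => prodM _ _ _ (rG w) (jG w) (phinM n (Y w)).1 (phinM n (Y w)).2) (ev _ Y G).
apply: complex_ext.
  apply: (cvg_unique _ cR) => //; apply: cvg_trans cR'.
  by apply: near_eq_cvg; apply: nearW => n; rewrite FGn.
apply: (cvg_unique _ cI) => //; apply: cvg_trans cI'.
by apply: near_eq_cvg; apply: nearW => n; rewrite FGn.
Qed.

End Transfer.

(** * Joint laws and independence *)

Section Indicators.
Context d (T : measurableType d) (R : realType) (P : probability T R).

Lemma expC_bool (b : T -> bool) : measurable [set w | b w] ->
  expC P (fun w => (b w)%:R) = (fine (P [set w | b w]))%:C.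
Proof.
move=> mb; apply: complex_ext => /=; last first.
  rewrite -[RHS](mean_cst P); congr (Rintegral _ _ _); apply/funext => w.
  by case: (b w).
rewrite -[in RHS](setIT [set w | b w]) -integral_indic// /Rintegral.
congr (fine _); apply: eq_integral => w _; congr (_%:E).
rewrite indicE (_ : (w \in _) = b w); first by case: (b w).
by apply/idP/idP; rewrite inE.
Qed.

End Indicators.

Section RandomVariables.
Context d (T : measurableType d).

Lemma rat_rvZ (a : rat) (X : T -> rat) : rat_rv X -> rat_rv (fun w => a * X w).
Proof. by move=> mX A; exact: (mX [set x | A (a * x)]). Qed.

Lemma rat_rvDc (X : T -> rat) (a : rat) : rat_rv X -> rat_rv (fun w => X w + a).
Proof. by move=> mX A; exact: (mX [set x | A (x + a)]). Qed.

Lemma rat_rvD (X Y : T -> rat) : rat_rv X -> rat_rv Y -> rat_rv (fun w => X w + Y w).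
Proof.
(* Countability of [rat] turns the preimage into a countable union over the value [a] of [X]. *)
move=> mX mY A; rewrite (_ : _ @^-1` A =
  \bigcup_(a in setT) (X @^-1` [set a] `&` Y @^-1` [set y | A (a + y)])).
  by apply: bigcupT_measurable_rat => a; exact: measurableI.
by apply/seteqP; split=> [w Aw|w [a _ [/= <-]]//]; exists (X w).
Qed.

Lemma rat_rv_eq (X : T -> rat) (a : rat) : rat_rv X -> measurable [set w | X w == a].
Proof.
move=> mX; rewrite (_ : [set w | _] = X @^-1` [set a])//.
by apply/seteqP; split=> w /= /eqP.
Qed.

End RandomVariables.

Section Laws.
Context d (T : measurableType d) d' (T' : measurableType d') (R : realType).
Variables (P : probability T R) (P' : probability T' R).

Lemma expC_eq_atoms (X : T -> rat) (Y : T' -> rat) (phi : rat -> R[i]) :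
  rat_rv X -> rat_rv Y ->
  (forall a, P (X @^-1` [set a]) = P' (Y @^-1` [set a])) ->
  boundedC phi ->
  expC P (fun w => phi (X w)) = expC P' (fun w => phi (Y w)).
Proof.
move=> mX mY XY phiM.
have h a : expC P (fun w => 1 * (X w == a)%:R) = expC P' (fun w => 1 * (Y w == a)%:R).
  under eq_fun do rewrite mul1r; under [in RHS]eq_fun do rewrite mul1r.
  rewrite !expC_bool; [|exact: rat_rv_eq..].
  rewrite (_ : [set w | _] = X @^-1` [set a]) ?XY; last first.
    by apply/seteqP; split=> w /= /eqP.
  by congr (fine (P' _))%:C; apply/seteqP; split=> w /= /eqP.
have := expC_transfer mX mY (bmc_cst T 1) (bmc_cst T' 1) phiM h.
under eq_fun do rewrite mul1r.
by under [in RHS]eq_fun do rewrite mul1r.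
Qed.

Lemma same_law_atoms (X : T -> rat) (Y : T' -> rat) :
  rat_rv X -> rat_rv Y ->
  (forall a, P (X @^-1` [set a]) = P' (Y @^-1` [set a])) -> same_law P X P' Y.
Proof.
move=> mX mY XY A.
have XA : [set w | X w \in A] = X @^-1` A by apply/seteqP; split=> w /=; rewrite inE.
have YA : [set w | Y w \in A] = Y @^-1` A by apply/seteqP; split=> w /=; rewrite inE.
have : expC P (fun w => (X w \in A)%:R) = expC P' (fun w => (Y w \in A)%:R).
  apply: (expC_eq_atoms mX mY (phi := fun x => (x \in A)%:R)) => //.
  by exists 1 => x; case: (x \in A); rewrite /= ?normr1 ?normr0.
rewrite !expC_bool ?XA ?YA// => /(congr1 (fun z => (Re z)%:E)) /=.
by rewrite !fineK// fin_num_measure.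
Qed.

Lemma expC_same_law2 (X1 X2 : T -> rat) (Y1 Y2 : T' -> rat) (phi psi : rat -> R[i]) :
  rat_rv X1 -> rat_rv X2 -> rat_rv Y1 -> rat_rv Y2 -> same_law2 P X1 X2 P' Y1 Y2 ->
  boundedC phi ->
  boundedC psi ->
  expC P (fun w => phi (X1 w) * psi (X2 w)) = expC P' (fun w => phi (Y1 w) * psi (Y2 w)).
Proof.
move=> mX1 mX2 mY1 mY2 XY phiM psiM.
(* First [psi] is reduced to an atom [b], with [phi] as weight; then [phi] is reduced to an atom
   [a], with the indicator of [b] as weight. What remains is the hypothesis on a rectangle of
   singletons. *)
apply: (expC_transfer mX2 mY2 (bmc_rv mX1 phiM) (bmc_rv mY1 phiM) psiM) => b.
under eq_fun do rewrite mulrC; under [in RHS]eq_fun do rewrite mulrC.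
apply: (expC_transfer mX1 mY1 (bmc_eq R b mX2) (bmc_eq R b mY2) phiM) => a.
under eq_fun do rewrite -natrM mulnb; under [in RHS]eq_fun do rewrite -natrM mulnb.
have e S (Z1 Z2 : S -> rat) :
    [set w | (Z2 w == b) && (Z1 w == a)] = Z1 @^-1` [set a] `&` Z2 @^-1` [set b].
  by apply/seteqP; split=> w /=; [move=> /andP[/eqP-> /eqP->] | move=> [-> ->]; rewrite !eqxx].
by rewrite !expC_bool; [rewrite !e XY | rewrite e; exact: measurableI..].
Qed.

End Laws.

Section Independence.
Context d (T : measurableType d) (R : realType) (P : probability T R).

(** The factor [k] enters the transfer as a constant weight, with [X] on both sides. *)
Lemma expC_prod_atoms (F : T -> R[i]) (X : T -> rat) (phi : rat -> R[i]) (k : R[i]) :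
  bmc F -> rat_rv X -> boundedC phi ->
  (forall a, expC P (fun w => F w * (X w == a)%:R) =
             k * expC P (fun w => (X w == a)%:R)) ->
  expC P (fun w => F w * phi (X w)) = k * expC P (fun w => phi (X w)).
Proof.
move=> bF mX phiM Fa; rewrite -expCZ; last exact: bmc_rv.
apply: expC_transfer => // [|a]; first exact: bmc_cst.
by rewrite Fa expCZ//; exact: bmc_eq.
Qed.

(** The four functions are replaced by indicators of atoms one after the other, each being moved to
    the last place first; on atoms the claim is [indep4] for singletons. *)
Lemma expC_indep4 (X1 X2 X3 X4 : T -> rat) (f1 f2 f3 f4 : rat -> R[i]) :
  rat_rv X1 -> rat_rv X2 -> rat_rv X3 -> rat_rv X4 -> indep4 P X1 X2 X3 X4 ->
  boundedC f1 ->
  boundedC f2 ->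
  boundedC f3 ->
  boundedC f4 ->
  expC P (fun w => f1 (X1 w) * f2 (X2 w) * f3 (X3 w) * f4 (X4 w)) =
  expC P (fun w => f1 (X1 w)) * expC P (fun w => f2 (X2 w)) *
  expC P (fun w => f3 (X3 w)) * expC P (fun w => f4 (X4 w)).
Proof.
move=> m1 m2 m3 m4 ind M1 M2 M3 M4.
have b1 := bmc_rv m1 M1; have b2 := bmc_rv m2 M2; have b3 := bmc_rv m3 M3.
apply: (expC_prod_atoms (bmcM (bmcM b1 b2) b3) m4 M4) => a4.
under eq_fun do rewrite mulrAC; rewrite mulrAC.
have c4 := bmc_eq R a4 m4.
apply: (expC_prod_atoms (bmcM (bmcM b1 b2) c4) m3 M3) => a3.
have c3 := bmc_eq R a3 m3.
under eq_fun do rewrite [_ * f2 _]mulrC -!mulrA mulrC.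
rewrite [_ * expC P (fun w => f2 _)]mulrC -!mulrA mulrC.
apply: (expC_prod_atoms (bmcM b1 (bmcM c4 c3)) m2 M2) => a2.
have c2 := bmc_eq R a2 m2.
under eq_fun do rewrite -!mulrA mulrC.
rewrite -!mulrA mulrC.
apply: (expC_prod_atoms (bmcM c4 (bmcM c3 c2)) m1 M1) => a1.
under eq_fun do rewrite -!natrM !mulnb.
rewrite !expC_bool; [|by apply: rat_rv_eq..|]; last first.
  rewrite (_ : [set w | _] = [set w | X4 w == a4] `&` ([set w | X3 w == a3] `&`
    [set w | X2 w == a2]) `&` [set w | X1 w == a1]).
    by do ?apply: measurableI; exact: rat_rv_eq.
  by apply/seteqP; split=> w /=; [move=> /andP[/and3P[? ? ?] ?] |
    move=> [[? [? ?]] ?]; apply/andP; split=> //; apply/and3P].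
have e (Z : T -> rat) a : [set w | Z w == a] = Z @^-1` [set a].
  by apply/seteqP; split=> w /= /eqP.
rewrite -!rmorphM /= !e.
have -> : [set w | (X4 w == a4) && ((X3 w == a3) && (X2 w == a2)) && (X1 w == a1)] =
  X1 @^-1` [set a1] `&` X2 @^-1` [set a2] `&` X3 @^-1` [set a3] `&` X4 @^-1` [set a4].
  apply/seteqP; split=> w /=; first by move=> /andP[/and3P[/eqP ? /eqP ? /eqP ?] /eqP ?].
  by move=> [[[-> ->] ->] ->]; rewrite !eqxx.
rewrite ind !fineM ?fin_numM ?fin_num_measure//.
by congr (_%:C); ring.
Qed.

End Independence.

(** * Characteristic functions along the real line *)

Section Exponential.
Variable R : realType.
Implicit Types x y t : R.

(** The exponential [exp(2 pi i x)], normalised to have period 1. *)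
Definition e2pi x : R[i] := cos (2 * pi * x) +i* sin (2 * pi * x).

Lemma e2piD x y : e2pi (x + y) = e2pi x * e2pi y.
Proof.
apply: complex_ext; rewrite ?Re_mul ?Im_mul /= mulrDr ?cosD ?sinD//.
by rewrite addrC.
Qed.

Lemma e2pi0 : e2pi 0 = 1.
Proof. by rewrite /e2pi mulr0 cos0 sin0. Qed.

Lemma e2piN x : e2pi (- x) = (e2pi x)^*%C.
Proof. by rewrite /e2pi mulrN cosN sinN. Qed.

Lemma e2piVN x : e2pi x * e2pi (- x) = 1.
Proof. by rewrite -e2piD subrr e2pi0. Qed.

Lemma e2pi_half : e2pi 2^-1 = -1.
Proof.
rewrite /e2pi mulrAC divff ?pnatr_eq0// mul1r cospi sinpi.
by apply: complex_ext; rewrite /= ?oppr0.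
Qed.

Lemma e2pi_nat (n : nat) : e2pi n%:R = 1.
Proof.
elim: n => [|n IHn]; first exact: e2pi0.
(* The value at 1 is the square of the value -1 at one half. *)
rewrite -addn1 natrD e2piD IHn mul1r (splitr 1) e2piD !div1r e2pi_half.
by rewrite mulrNN mulr1.
Qed.

Lemma e2pi_int (m : int) : e2pi m%:~R = 1.
Proof.
case: (intP m) => [|n|n]; first exact: e2pi0; first exact: e2pi_nat.
by rewrite rmorphN e2piN [X in X^*]e2pi_nat conjc1.
Qed.

Lemma e2pi_bound x : `|Re (e2pi x)| <= 1 /\ `|Im (e2pi x)| <= 1.
Proof. by rewrite /= cos_max sin_max. Qed.

Lemma e2pi_ratr_bound t :
  boundedC (fun q : rat => e2pi (t * ratr q)).
Proof. by exists 1 => q; exact: e2pi_bound. Qed.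

(** The denominator of [q] divides [n!] as soon as it is at most [n]. *)
Lemma ratr_fact_int (q : rat) : exists N, forall n, (N <= n)%N ->
  exists m : int, n`!%:R * ratr q = m%:~R :> R.
Proof.
exists `|denq q|%N => n qn.
have /dvdnP[k kE] : (`|denq q| %| n`!)%N.
  by apply: dvdn_fact; rewrite qn absz_gt0 denq_neq0.
exists (k%:Z * numq q); rewrite kE /ratr natrM -mulrA rmorphM/=; congr (_ * _).
have -> : `|denq q|%:R = (denq q)%:~R :> R.
  by rewrite -[in RHS](gez0_abs (denq_ge0 q)).
by rewrite mulrCA divff ?mulr1// intr_eq0 denq_neq0.
Qed.

End Exponential.

Definition charf d (T : measurableType d) (R : realType) (P : probability T R)
  (X : T -> rat) (t : R) : R[i] := expC P (fun w => e2pi (t * ratr (X w))).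

Section CharacteristicFunction.
Context d (T : measurableType d) (R : realType) (P : probability T R).
Implicit Types (X : T -> rat) (t : R).

Lemma bmc_e2pi X t : rat_rv X -> bmc (fun w => e2pi (t * ratr (X w))).
Proof. by move=> mX; apply: (bmc_rv mX (e2pi_ratr_bound t)). Qed.

Lemma charf_at0 X : charf P X 0 = 1.
Proof. by rewrite /charf; under eq_fun do rewrite mul0r e2pi0; exact: expC_cst. Qed.

Lemma charfN X t : rat_rv X -> charf P X (- t) = (charf P X t)^*%C.
Proof.
move=> mX; rewrite /charf; under eq_fun do rewrite mulNr e2piN.
have [bR bI] := bmc_e2pi t mX.
by apply: complex_ext => //=; rewrite meanN.
Qed.

(** The map [x |-> e2pi (t * ratr x)] is a character of the rationals, so the hypothesis applies to
    its real and imaginary parts. *)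
Lemma charf_neq0 X t : rat_rv X -> charfun_nonvanishing P X -> charf P X t != 0.
Proof.
move=> mX nX; apply/eqP => -[R0 I0].
apply: (nX (fun x => Re (e2pi (t * ratr x))) (fun x => Im (e2pi (t * ratr x)))).
  split; first by move=> x; rewrite /= cos2Dsin2.
  split=> x y; rewrite rmorphD mulrDr e2piD ?Re_mul ?Im_mul//.
  by rewrite addrC.
have [bR bI] := bmc_e2pi t mX.
split.
  rewrite -[LHS]fineK; first by rewrite [X in X%:E]R0.
  by apply: integrable_fin_num => //; exact: bmf_integrable.
rewrite -[LHS]fineK; first by rewrite [X in X%:E]I0.
by apply: integrable_fin_num => //; exact: bmf_integrable.
Qed.

Lemma charf_continuous X : rat_rv X ->
  continuous (fun t => Re (charf P X t)) /\ continuous (fun t => Im (charf P X t)).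
Proof.
move=> mX.
have cR (q : rat) : continuous (fun t : R => Re (e2pi (t * ratr q))).
  move=> t /=; apply: continuous_comp; last exact: continuous_cos.
  by apply: cvgM; [exact: cvg_cst | apply: cvgM; [exact: cvg_id | exact: cvg_cst]].
have cI (q : rat) : continuous (fun t : R => Im (e2pi (t * ratr q))).
  move=> t /=; apply: continuous_comp; last exact: continuous_sin.
  by apply: cvgM; [exact: cvg_cst | apply: cvgM; [exact: cvg_id | exact: cvg_cst]].
have ci (f : R -> T -> R) : (forall l, bmf (f l)) -> (forall w, continuous (f ^~ w)) ->
    (forall l w, `|f l w| <= 1) -> continuous (fun l => \int[P]_w f l w).
  move=> bf cf f1 t.
  (* Continuity at [t] is local, so any bounded open interval around [t] serves; the integrands are
     dominated by 1. *)
  apply: (@continuity_under_integral _ _ _ P f setT measurableT (t - 1) (t + 1)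
    _ _ (cst 1)).
  - by move=> l _; exact: bmf_integrable.
  - by apply: aeW => w _ l _; exact: cf.
  - exact: (bmf_integrable P (bmf_cst T 1)).
  - by move=> l _; apply: aeW => w _; exact: f1.
  - by rewrite inE /= in_itv/= ltrBlDr ltrDl ltr01.
split; apply: ci => [l|w|l w].
- by have [] := bmc_e2pi l mX.
- exact: cR.
- by case: (e2pi_bound (l * ratr (X w))).
- by have [] := bmc_e2pi l mX.
- exact: cI.
- by case: (e2pi_bound (l * ratr (X w))).
Qed.

(* [n`! * X] is eventually an integer at every sample point. *)
Lemma charf_fact_cvg X t : rat_rv X ->
  (fun n => Re (charf P X (t + n`!%:R))) @ \oo --> Re (charf P X t) /\
  (fun n => Im (charf P X (t + n`!%:R))) @ \oo --> Im (charf P X t).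
Proof.
move=> mX; apply: (expC_cvg P (fun n => bmc_e2pi (t + n`!%:R) mX)) => [n w|w].
  exact: e2pi_bound.
have [N XN] := ratr_fact_int R (X w); exists N => n /XN[m mE].
by rewrite mulrDl e2piD mE e2pi_int mulr1.
Qed.

(** The exponent is regrouped by variable, after which independence factors the expectation. *)
Lemma charf_linear_forms (X1 X2 X3 X4 : T -> rat) (a2 a3 b2 b3 : rat) (u v : R) :
  rat_rv X1 -> rat_rv X2 -> rat_rv X3 -> rat_rv X4 -> indep4 P X1 X2 X3 X4 ->
  expC P (fun w => e2pi (u * ratr (X1 w + a2 * X2 w + a3 * X3 w)) *
                   e2pi (v * ratr (b2 * X2 w + b3 * X3 w + X4 w))) =
  charf P X1 u * charf P X2 (ratr a2 * u + ratr b2 * v) *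
  charf P X3 (ratr a3 * u + ratr b3 * v) * charf P X4 v.
Proof.
move=> m1 m2 m3 m4 ind; rewrite /charf.
rewrite -(expC_indep4 m1 m2 m3 m4 ind (e2pi_ratr_bound u) (e2pi_ratr_bound _)
  (e2pi_ratr_bound _) (e2pi_ratr_bound v)).
congr expC; apply/funext => w; rewrite -!e2piD; congr e2pi.
by rewrite !rmorphD !rmorphM/=; ring.
Qed.

End CharacteristicFunction.

Lemma charf_same_law d (T : measurableType d) d' (T' : measurableType d')
  (R : realType) (P : probability T R) (P' : probability T' R)
  (X : T -> rat) (Y : T' -> rat) (t : R) :
  rat_rv X -> rat_rv Y -> same_law P X P' Y -> charf P X t = charf P' Y t.
Proof.
move=> mX mY XY.
exact: (expC_eq_atoms mX mY (fun a => XY [set a]) (e2pi_ratr_bound t)).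
Qed.

(** * Unitary characters of the rationals *)

Definition unitary_char (R : realType) (chi : rat -> R[i]) : Prop :=
  (forall q r, chi (q + r) = chi q * chi r) /\ (forall q, chi q * (chi q)^*%C = 1).

Section UnitaryCharacter.
Context (R : realType) (chi : rat -> R[i]) (chiP : unitary_char chi).

Lemma unitary_char0 : chi 0 = 1.
Proof.
have n0 : chi 0 != 0.
  by apply/eqP => c0; have := chiP.2 0; rewrite c0 mul0r => /esym/eqP; rewrite oner_eq0.
by apply: (mulfI n0); rewrite -chiP.1 addr0 mulr1.
Qed.

Lemma unitary_charN q : chi (- q) = (chi q)^*%C.
Proof.
have n0 : chi q != 0.
  by apply/eqP => c0; have := chiP.2 q; rewrite c0 mul0r => /esym/eqP; rewrite oner_eq0.
by apply: (mulfI n0); rewrite chiP.2 -chiP.1 subrr unitary_char0.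
Qed.

Lemma unitary_char_sqr q : Re (chi q) ^+ 2 + Im (chi q) ^+ 2 = 1.
Proof.
have := congr1 (fun z => Re z) (chiP.2 q); case: (chi q) => a b /=.
by rewrite mulrN opprK !expr2.
Qed.

Lemma unitary_char_Re_le1 q : `|Re (chi q)| <= 1.
Proof.
rewrite -(@ler_pXn2r _ 2)// ?nnegrE// expr1n real_normK ?num_real//.
by rewrite -(unitary_char_sqr q) lerDl sqr_ge0.
Qed.

(** This is why a kernel built from real parts alone detects the trivial character. *)
Lemma unitary_char_eq1 q : Re (chi q) = 1 -> chi q = 1.
Proof.
move=> c1; apply: complex_ext => //=; have := unitary_char_sqr q.
by rewrite c1 expr1n -[RHS]addr0 => /addrI/eqP; rewrite sqrf_eq0 => /eqP.
Qed.

(** The product-to-sum formula for cosines, which expands products of kernel factors into linear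
    combinations of characters. *)
Lemma Re_unitary_charM q r :
  Re (chi r) * Re (chi q) = 2^-1 * Re (chi (r + q)) + 2^-1 * Re (chi (r - q)).
Proof.
rewrite !chiP.1 unitary_charN !Re_mul; case: (chi q) (chi r) => [a b] [c s] /=.
by field.
Qed.

End UnitaryCharacter.

(* A Bohr-Fejer type kernel on the dual group of [rat]: a trigonometric
   polynomial converging pointwise to the indicator of the trivial character. *)
Definition char_kernel (R : realType) (chi : rat -> R[i]) (qs : seq rat) : R :=
  \prod_(q <- qs) ((1 + Re (chi q)) / 2).

(** Each of the first [n] codes is listed [n] times, so the corresponding kernel factors occur to
    the power [n]. A code of no rational yields the default 0, whose factor is 1. *)
Definition kernel_points (n : nat) : seq rat :=
  flatten (nseq n [seq odflt 0 (unpickle i) | i <- iota 0 n]).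

Lemma char_kernel_itv (R : realType) (chi : rat -> R[i]) (qs : seq rat) :
  unitary_char chi -> 0 <= char_kernel chi qs <= 1.
Proof.
move=> chiP; rewrite /char_kernel; elim/big_ind: _ => [|x y /andP[x0 x1] /andP[y0 y1]|q _].
- by rewrite ler01 lexx.
- by rewrite mulr_ge0//= mulr_ile1.
- have := unitary_char_Re_le1 chiP q; rewrite ler_norml => /andP[h1 h2].
  by apply/andP; split; lra.
Qed.

(** If [chi q] differs from 1, the factor [z] at [q] lies in [[0, 1)] and occurs at least [n] times
    once [n] exceeds the code of [q]; the other factors are at most 1, so the kernel is bounded by
    [z ^+ n]. *)
Lemma char_kernel_cvg (R : realType) (chi : rat -> R[i]) : unitary_char chi ->
  (fun n => char_kernel chi (kernel_points n)) @ \oo -->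
  (`[< forall q, chi q = 1 >]%:R : R).
Proof.
move=> chiP.
have kE s n : char_kernel chi (flatten (nseq n s)) = char_kernel chi s ^+ n.
  elim: n => [|n IHn]; first by rewrite /char_kernel big_nil expr0.
  by rewrite /= /char_kernel big_cat /= exprS -IHn.
have [chi1|/existsNP[q /eqP chiq]] := pselect (forall q, chi q = 1).
  rewrite asboolT//; apply: cvg_near_cst; apply: nearW => n; rewrite /char_kernel.
  by apply: big1 => q _; rewrite chi1 /=; lra.
rewrite asboolF; last by move=> /(_ q) /eqP; apply/negP.
pose z := (1 + Re (chi q)) / 2.
have [z0 z1] : 0 <= z /\ z < 1.
  have := unitary_char_Re_le1 chiP q; rewrite ler_norml => /andP[h1 h2].
  have : Re (chi q) != 1 by apply: contra_neq chiq; exact: unitary_char_eq1.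
  move=> h; have : Re (chi q) < 1 by rewrite lt_neqAle h.
  by rewrite /z => ?; split; lra.
apply: (squeeze_cvgr (f := cst 0) (h := fun n => z ^+ n)); [|exact: cvg_cst|]; last first.
  by apply: cvg_expr; rewrite ger0_norm.
exists (pickle q).+1 => // n /= qn; rewrite kE.
have /andP[k0 k1] := char_kernel_itv [seq odflt 0 (unpickle i) | i <- iota 0 n] chiP.
rewrite exprn_ge0//=; apply: lerXn2r; rewrite ?nnegrE//.
have qin : q \in [seq odflt 0 (unpickle i) | i <- iota 0 n].
  by apply/mapP; exists (pickle q); rewrite ?mem_iota ?pickleK.
rewrite /char_kernel (big_rem q)//= -/z -[leRHS]mulr1 ler_wpM2l//.
by have /andP[] := char_kernel_itv (rem q [seq odflt 0 (unpickle i) | i <- iota 0 n]) chiP.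
Qed.

Section TrivialCharacter.
Context d (T : measurableType d) d' (T' : measurableType d') (R : realType).
Variables (P : probability T R) (P' : probability T' R).
Variables (Phi : T -> rat -> R[i]) (Psi : T' -> rat -> R[i]).
Hypotheses (PhiP : forall w, unitary_char (Phi w)) (PsiP : forall w, unitary_char (Psi w)).
Hypotheses (bPhi : forall q, bmc (Phi^~ q)) (bPsi : forall q, bmc (Psi^~ q)).
Hypothesis PhiPsi : forall q, expC P (Phi^~ q) = expC P' (Psi^~ q).

Lemma bmf_char_kernel d0 (S : measurableType d0) (Xi : S -> rat -> R[i]) qs :
  (forall q, bmc (Xi^~ q)) -> bmf (fun w => char_kernel (Xi w) qs).
Proof.
move=> bXi; elim: qs => [|q qs IHqs].
  by under eq_fun do rewrite /char_kernel big_nil; exact: bmf_cst.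
under eq_fun do rewrite /char_kernel big_cons.
apply: bmfM => //; apply: bmfM; last exact: bmf_cst.
by apply: bmfD; [exact: bmf_cst | exact: (bXi q).1].
Qed.

(** The extra frequency [r] makes the induction close: a new factor at [q] splits it into [r],
    [r + q] and [r - q]. *)
Lemma mean_char_kernel qs r :
  \int[P]_w (Re (Phi w r) * char_kernel (Phi w) qs) =
  \int[P']_w (Re (Psi w r) * char_kernel (Psi w) qs).
Proof.
elim: qs r => [|q qs IHqs] r.
  under eq_fun do rewrite /char_kernel big_nil mulr1.
  under [in RHS]eq_fun do rewrite /char_kernel big_nil mulr1.
  exact: (congr1 (fun z => Re z) (PhiPsi r)).
have stepE (chi : rat -> R[i]) : unitary_char chi ->
    Re (chi r) * char_kernel chi (q :: qs) = 2^-1 * (Re (chi r) * char_kernel chi qs) +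
    (4^-1 * (Re (chi (r + q)) * char_kernel chi qs) +
     4^-1 * (Re (chi (r - q)) * char_kernel chi qs)).
  move=> chiP; rewrite /char_kernel big_cons -/(char_kernel chi qs).
  rewrite [LHS](_ : _ = (Re (chi r) + Re (chi r) * Re (chi q)) / 2 * char_kernel chi qs).
    by rewrite (Re_unitary_charM chiP); field.
  by field.
under eq_fun do rewrite stepE//.
under [in RHS]eq_fun do rewrite stepE//.
have b1 s := bmfM (bPhi s).1 (bmf_char_kernel qs bPhi).
have b2 s := bmfM (bPsi s).1 (bmf_char_kernel qs bPsi).
have c1 k s := bmfM (bmf_cst T k) (b1 s).
have c2 k s := bmfM (bmf_cst T' k) (b2 s).
rewrite (meanD P (c1 _ r) (bmfD (c1 _ (r + q)) (c1 _ (r - q)))).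
rewrite (meanD P (c1 _ (r + q)) (c1 _ (r - q))).
rewrite (meanD P' (c2 _ r) (bmfD (c2 _ (r + q)) (c2 _ (r - q)))).
rewrite (meanD P' (c2 _ (r + q)) (c2 _ (r - q))).
by rewrite !meanZ// !IHqs.
Qed.

(** Limit of the kernel identity at frequency [r = 0], where every character equals 1. *)
Lemma mean_trivial_char :
  \int[P]_w (`[< forall q, Phi w q = 1 >]%:R : R) =
  \int[P']_w (`[< forall q, Psi w q = 1 >]%:R : R).
Proof.
have k1 S (Xi : S -> rat -> R[i]) : (forall w, unitary_char (Xi w)) ->
    forall n w, `|char_kernel (Xi w) (kernel_points n)| <= 1.
  by move=> XiP n w; have /andP[k0 k1] := char_kernel_itv (kernel_points n) (XiP w);
    rewrite ger0_norm.
have [_ c1] := bounded_convergence P (fun n => (bmf_char_kernel (kernel_points n) bPhi).1)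
  (k1 _ _ PhiP) (fun w => char_kernel_cvg (PhiP w)).
have [_ c2] := bounded_convergence P' (fun n => (bmf_char_kernel (kernel_points n) bPsi).1)
  (k1 _ _ PsiP) (fun w => char_kernel_cvg (PsiP w)).
apply: (cvg_unique _ c1) => //; apply: cvg_trans c2.
apply: near_eq_cvg; apply: nearW => n.
have := mean_char_kernel (kernel_points n) 0.
under eq_fun do rewrite (unitary_char0 (PhiP _)) mul1r.
by under [in RHS]eq_fun do rewrite (unitary_char0 (PsiP _)) mul1r.
Qed.

End TrivialCharacter.

(** * Homomorphic ratios come from rational shifts *)

Section Shift.
Context d (T : measurableType d) d' (T' : measurableType d') (R : realType).
Variables (P : probability T R) (P' : probability T' R).
Variables (X : T -> rat) (Y : T' -> rat).
Hypotheses (mX : rat_rv X) (mY : rat_rv Y).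

Lemma e2pi_norm (x : R) : e2pi x * (e2pi x)^*%C = 1.
Proof. by rewrite -e2piN e2piVN. Qed.

Lemma e2pi_all1 (x : rat) : (forall q : rat, e2pi (ratr (q * x)) = 1 :> R[i]) <-> x = 0.
Proof.
split=> [e1|-> q]; last by rewrite mulr0 rmorph0 e2pi0.
(* For nonzero [x] the test frequency [q = 1 / (2 x)] gives the value -1. *)
apply/eqP/negPn/negP => x0; have := e1 (2^-1 * x^-1).
rewrite mulfVK// fmorphV /= ratr_nat e2pi_half => /eqP.
by rewrite -subr_eq0 -opprD oppr_eq0 -[1 + 1]/(2%:R) pnatr_eq0.
Qed.

Lemma unitary_char_e2pi (x : rat) : unitary_char (fun q => e2pi (ratr (q * x)) : R[i]).
Proof.
split=> [q r|q]; last exact: e2pi_norm.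
by rewrite mulrDl rmorphD e2piD.
Qed.

Lemma unitary_charM (f g : rat -> R[i]) :
  unitary_char f -> unitary_char g -> unitary_char (fun q => f q * g q).
Proof.
move=> [fD f1] [gD g1]; split=> [q r|q]; first by rewrite fD gD mulrACA.
by rewrite rmorphM/= mulrACA f1 g1 mulr1.
Qed.

(** If all atoms were null, the weights 1 and 0 would agree on atoms, and the transfer would give 1
    = 0. *)
Lemma exists_atom : exists a, P' (Y @^-1` [set a]) != 0%E.
Proof.
apply: contrapT => /forallNP PY0.
have h a : expC P' (fun w => 1 * (Y w == a)%:R) = expC P' (fun w => 0 * (Y w == a)%:R).
  under eq_fun do rewrite mul1r; under [in RHS]eq_fun do rewrite mul0r.
  rewrite expC_bool ?expC_cst; last exact: rat_rv_eq.
  rewrite (_ : [set w | _] = Y @^-1` [set a]); last first.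
    by apply/seteqP; split=> w /= /eqP.
  by have /negP/negPn/eqP -> := PY0 a.
have M1 : boundedC (fun=> 1 : R[i]).
  by exists 1 => _ /=; rewrite normr1 normr0.
have := expC_transfer mY mY (bmc_cst T' 1) (bmc_cst T' 0) M1 h.
under eq_fun do rewrite mulr1; under [in RHS]eq_fun do rewrite mul0r.
by rewrite !expC_cst => /eqP; rewrite oner_eq0.
Qed.

Lemma shift_of_charf (h : rat -> R[i]) : unitary_char h ->
  (forall q : rat, charf P' Y (ratr q) = h q * charf P X (ratr q)) ->
  exists al : rat, same_law P' Y P (fun w => X w + al).
Proof.
move=> hP hXY.
(* Both random characters have the same mean at each [q]; [Psi y w] is trivial exactly when
   [Y w = y]. *)
pose Phi y w q := h q * (e2pi (ratr (q * (X w - y))) : R[i]).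
pose Psi y w q := (e2pi (ratr (q * (Y w - y))) : R[i]).
have PhiP y w : unitary_char (Phi y w).
  by apply: unitary_charM => //; exact: unitary_char_e2pi.
have PsiP y w : unitary_char (Psi y w) by exact: unitary_char_e2pi.
have ebound q y : boundedC (fun x => e2pi (ratr (q * (x - y))) : R[i]).
  by exists 1 => x; exact: e2pi_bound.
have bPhi y q : bmc (fun w => Phi y w q).
  apply: bmcM; first exact: bmc_cst.
  exact: (bmc_rv mX (ebound q y)).
have bPsi y q : bmc (fun w => Psi y w q) by exact: (bmc_rv mY (ebound q y)).
have PhiPsi y q : expC P' (fun w => Psi y w q) = expC P (fun w => Phi y w q).
  have eE x : e2pi (ratr (q * (x - y))) = e2pi (ratr (- (q * y))) * e2pi (ratr q * ratr x) :> R[i].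
    by rewrite mulrBr addrC rmorphD rmorphM e2piD.
  rewrite /Psi /Phi; under eq_fun do rewrite eE.
  under [in RHS]eq_fun do rewrite eE mulrCA.
  have bX := bmc_e2pi (ratr q) mX; have bY := bmc_e2pi (ratr q) mY.
  rewrite expCZ// expCZ; last by apply: bmcM => //; exact: bmc_cst.
  by rewrite expCZ//; congr (_ * _); exact: hXY.
have key y := mean_trivial_char (PsiP y) (PhiP y) (bPsi y) (bPhi y) (PhiPsi y).
have PsiE y : \int[P']_w (`[< forall q, Psi y w q = 1 >]%:R : R) = fine (P' (Y @^-1` [set y])).
  rewrite -[RHS](_ : Re (expC P' (fun w => (Y w == y)%:R)) = _); last first.
    rewrite expC_bool; last exact: rat_rv_eq.
    by congr (fine (P' _)); apply/seteqP; split=> w /= /eqP.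
  congr Rintegral; apply/funext => w.
  rewrite (_ : `[< _ >] = (Y w == y)); first by case: (Y w == y).
  by apply/asboolP/eqP => [/e2pi_all1/eqP|/eqP]; rewrite ?subr_eq0;
    [move/eqP | rewrite -subr_eq0 => /eqP /e2pi_all1].
have [y0 Py0] := exists_atom.
(* Since [y0] has positive mass, [Phi y0] is trivial with positive probability, hence at some sample
   point. *)
have [w0 w0P] : exists w, forall q, Phi y0 w q = 1.
  apply: contrapT => /forallNP N; move: Py0; apply/negP/negPn/eqP.
  rewrite -[LHS]fineK; last exact: (fin_num_measure P' _ (mY _)).
  rewrite -PsiE key; congr (_%:E); rewrite -[RHS](mean_cst P); congr Rintegral.
  by apply/funext => w; rewrite asboolF.
(* Triviality at [w0] says that [h q] is [e2pi] of [q * (y0 - X w0)], which identifies the shift. *)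
exists (y0 - X w0); apply: same_law_atoms => //; first exact: rat_rvDc.
move=> y; have PhiE : \int[P]_w (`[< forall q, Phi y w q = 1 >]%:R : R) =
    fine (P ((fun w => X w + (y0 - X w0)) @^-1` [set y])).
  rewrite -[RHS](_ : Re (expC P (fun w => (X w + (y0 - X w0) == y)%:R)) = _); last first.
    rewrite expC_bool; last by apply: (rat_rv_eq (X := fun w => X w + _)); exact: rat_rvDc.
    by congr (fine (P _)); apply/seteqP; split=> w /= /eqP.
  congr Rintegral; apply/funext => w.
  have PhiE q : Phi y w q = e2pi (ratr (q * (X w + (y0 - X w0) - y))).
    have -> : q * (X w + (y0 - X w0) - y) = q * (X w - y) - q * (X w0 - y0) by ring.
    rewrite rmorphB e2piD e2piN /Phi mulrC; congr (_ * _).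
    have := w0P q; rewrite /Phi => hq.
    by rewrite -[LHS]mulr1 -(e2pi_norm (ratr (q * (X w0 - y0)))) mulrA hq mul1r.
  rewrite (_ : `[< _ >] = (X w + (y0 - X w0) == y)); first by case: (_ == y).
  apply/asboolP/eqP => [a|a].
    by apply/eqP; rewrite -subr_eq0; apply/eqP/e2pi_all1 => q; rewrite -PhiE.
  by move=> q; rewrite PhiE a subrr mulr0 rmorph0 e2pi0.
have yE := etrans (esym (PsiE y)) (etrans (key y) PhiE).
rewrite -[LHS]fineK; last exact: (fin_num_measure P' _ (mY _)).
by rewrite yE fineK//; exact: (fin_num_measure P _ (rat_rvDc _ mX _)).
Qed.

End Shift.

(** * The functional equation *)

(** On the cube of the eight points with [a], [b], [c] in [{0, 1}], the second factor does not
    depend on [a], the third on [b], the fourth on [c], so all three cancel in the alternating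
    product. With general coefficients, any of the four factors can take the place of [h1]. *)
Lemma third_difference (K : fieldType) (h1 h2 h3 h4 : rat -> K)
  (p1 q1 p2 q2 p3 q3 p4 q4 : rat) :
  (forall t, h1 t != 0) -> (forall t, h2 t != 0) ->
  (forall t, h3 t != 0) -> (forall t, h4 t != 0) ->
  p1 * q2 - q1 * p2 != 0 -> p1 * q3 - q1 * p3 != 0 -> p1 * q4 - q1 * p4 != 0 ->
  (forall u v, h1 (p1 * u + q1 * v) * h2 (p2 * u + q2 * v) *
               h3 (p3 * u + q3 * v) * h4 (p4 * u + q4 * v) = 1) ->
  forall x y z, h1 (x + y + z) * h1 x * h1 y * h1 z =
                h1 (x + y) * h1 (x + z) * h1 (y + z) * h1 0.
Proof.
move=> n1 n2 n3 n4 D2 D3 D4 E x y z.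
(* Steps along the kernels of the second, third and fourth forms, on which the
   first form takes the values x, y and z. *)
pose s := x / (p1 * q2 - q1 * p2).
pose t := y / (p1 * q3 - q1 * p3).
pose r := z / (p1 * q4 - q1 * p4).
pose u a b c := a * (q2 * s) + b * (q3 * t) + c * (q4 * r).
pose v a b c := - (a * (p2 * s) + b * (p3 * t) + c * (p4 * r)).
pose l2 b c := p2 * u 0 b c + q2 * v 0 b c.
pose l3 a c := p3 * u a 0 c + q3 * v a 0 c.
pose l4 a b := p4 * u a b 0 + q4 * v a b 0.
have Eabc a b c : h1 (a * x + b * y + c * z) = (h2 (l2 b c) * h3 (l3 a c) * h4 (l4 a b))^-1.
  have := E (u a b c) (v a b c).
  have -> : p1 * u a b c + q1 * v a b c = a * x + b * y + c * z.
    have -> : x = s * (p1 * q2 - q1 * p2) by rewrite divfK.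
    have -> : y = t * (p1 * q3 - q1 * p3) by rewrite divfK.
    have -> : z = r * (p1 * q4 - q1 * p4) by rewrite divfK.
    by rewrite /u /v; ring.
  have -> : p2 * u a b c + q2 * v a b c = l2 b c by rewrite /l2 /u /v; ring.
  have -> : p3 * u a b c + q3 * v a b c = l3 a c by rewrite /l3 /u /v; ring.
  have -> : p4 * u a b c + q4 * v a b c = l4 a b by rewrite /l4 /u /v; ring.
  rewrite -!mulrA => e; apply: (mulIf (x := h2 (l2 b c) * (h3 (l3 a c) * h4 (l4 a b)))).
    by rewrite !mulf_neq0.
  by rewrite e mulVf// !mulf_neq0.
have {Eabc} E1 a b c w : w = a * x + b * y + c * z ->
    h1 w = (h2 (l2 b c) * h3 (l3 a c) * h4 (l4 a b))^-1 by move=> ->.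
rewrite (E1 1 1 1 (x + y + z)) ?(E1 1 0 0 x) ?(E1 0 1 0 y) ?(E1 0 0 1 z)
  ?(E1 1 1 0 (x + y)) ?(E1 1 0 1 (x + z)) ?(E1 0 1 1 (y + z)) ?(E1 0 0 0 0); try by ring.
by field; rewrite !n2 !n3 !n4.
Qed.

Section SquaredNorm.
Variable R : realType.
Implicit Types z w : R[i].

(** The squared modulus as an element of [R]: it is multiplicative, and its limits are limits of
    reals. *)
Definition sqn z : R := Re z ^+ 2 + Im z ^+ 2.

Lemma sqn_mul z w : sqn (z * w) = sqn z * sqn w.
Proof. by rewrite /sqn Re_mul Im_mul; ring. Qed.

Lemma sqn_eq0 z : (sqn z == 0) = (z == 0).
Proof.
by rewrite /sqn paddr_eq0 ?sqr_ge0// !sqrf_eq0 eq_complex.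
Qed.

Lemma sqn1 : sqn 1 = 1.
Proof. by rewrite /sqn /=; ring. Qed.

Lemma sqn_div z w : sqn (z / w) = sqn z / sqn w.
Proof.
have [->|w0] := eqVneq w 0; first by rewrite invr0 mulr0 /sqn /= expr0n /= !addr0 invr0 mulr0.
have nw : sqn w != 0 by rewrite sqn_eq0.
by apply: (mulIf nw); rewrite -sqn_mul !divfK.
Qed.

Lemma sqn_exp z n : sqn (z ^+ n) = sqn z ^+ n.
Proof. by elim: n => [|n IHn]; [rewrite !expr0 sqn1 | rewrite !exprS sqn_mul IHn]. Qed.

End SquaredNorm.

(** As [n!] is at least 1, the powers stay below [b] if [b < 1] and above [b] if [b > 1]. *)
Lemma exprn_fact_cvg1 (R : realType) (b : R) : 0 <= b ->
  (fun n => b ^+ n`!) @ \oo --> (1 : R) -> b = 1.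
Proof.
move=> b0 cb; have [b1|b1|//] := ltgtP b 1; exfalso.
- suff : 1 <= b by rewrite leNgt b1.
  rewrite -(cvg_lim _ cb)//; apply: limr_le; first by apply/cvg_ex; exists 1.
  apply: nearW => n; rewrite -[leRHS]expr1.
  by apply: ler_wiXn2l; rewrite ?b0 ?(ltW b1)// fact_gt0.
- suff : b <= 1 by rewrite leNgt b1.
  rewrite -[leRHS](cvg_lim _ cb)//; apply: limr_ge; first by apply/cvg_ex; exists 1.
  apply: nearW => n; rewrite -[leLHS]expr1.
  by apply: ler_weXn2l; rewrite ?(ltW b1)// fact_gt0.
Qed.

(* The bimultiplicative defect [B x y = h (x + y) / (h x * h y)] is positive, and
   [B x 1 ^+ n`! = B x n`!] tends to 1, so that [B = 1]. *)
Lemma quadratic_hom (R : realType) (h : rat -> R[i]) :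
  (forall x, h x != 0) -> h 0 = 1 -> (forall x, h (- x) = (h x)^*%C) ->
  (forall x y z, h (x + y + z) * h x * h y * h z =
                 h (x + y) * h (x + z) * h (y + z) * h 0) ->
  (forall x, (fun n => sqn (h (x + n`!%:R))) @ \oo --> sqn (h x)) ->
  forall x y, h (x + y) = h x * h y.
Proof.
move=> n0 h0 hN h3 hc.
pose B x y := h (x + y) / (h x * h y).
have Bn0 x y : B x y != 0 by rewrite /B mulf_neq0 ?invr_neq0 ?mulf_neq0.
have BC x y : B x y = B y x by rewrite /B addrC [h x * _]mulrC.
have BD x y z : B (x + y) z = B x z * B y z.
  have := h3 x y z; rewrite h0 mulr1 => e; rewrite /B.
  rewrite (_ : h (x + y + z) = h (x + y) * h (x + z) * h (y + z) / (h x * h y * h z)).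
    by field; rewrite !n0.
  by rewrite -e; field; rewrite !n0.
have B0 z : B 0 z = 1 by rewrite /B add0r h0 mul1r divff.
have BN x z : B (- x) z = (B x z)^-1.
  by apply: (mulIf (Bn0 x z)); rewrite -BD addNr B0 mulVf.
have BNN x y : B (- x) (- y) = B x y by rewrite BN BC BN invrK BC.
(* Negating both arguments conjugates [B] by [hN] and fixes it by bimultiplicativity, so [B] is
   real. *)
have BJ x y : (B x y)^*%C = B x y.
  by rewrite -[RHS]BNN /B -opprD !hN rmorphM fmorphV rmorphM.
have BIm x y : Im (B x y) = 0.
  have := congr1 (fun z => Im z) (BJ x y); case: (B x y) => a b /= e; lra.
(* Halving [x] exhibits [B x y] as the square of a real number. *)
have BRe x y : 0 <= Re (B x y).
  rewrite (_ : x = x / 2 + x / 2); last by field.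
  by rewrite BD Re_mul BIm mulr0 subr0 -expr2 sqr_ge0.
have Bnat x y n : B x (n%:R * y) = B x y ^+ n.
  elim: n => [|n IHn]; first by rewrite mul0r BC B0.
  by rewrite -natr1 mulrDl mul1r BC BD BC IHn [B y x]BC exprSr.
have B1 x : B x 1 = 1.
  have sB : sqn (B x 1) = 1.
    apply: exprn_fact_cvg1; first by rewrite /sqn addr_ge0 ?sqr_ge0.
    (* The form [0 + n!] lets [hc] be applied at 0. *)
    have sE n : sqn (B x 1) ^+ n`! = sqn (h (x + n`!%:R)) / (sqn (h x) * sqn (h (0 + n`!%:R))).
      by rewrite -sqn_exp -Bnat mulr1 /B add0r sqn_div sqn_mul.
    have sh y : sqn (h y) != 0 by rewrite sqn_eq0.
    have -> : 1 = sqn (h x) / (sqn (h x) * sqn (h 0)) by rewrite h0 sqn1 mulr1 divff.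
    under eq_fun do rewrite sE.
    apply: cvgM; first exact: hc.
    apply: cvgV; first by rewrite mulf_neq0.
    by apply: cvgM; [exact: cvg_cst | exact: hc].
  apply: complex_ext; rewrite ?BIm//=.
  move: sB; rewrite /sqn BIm expr0n addr0 => /eqP; rewrite sqrf_eq1 => /orP[/eqP//|/eqP e].
  by have := BRe x 1; rewrite e oppr_ge0 ler10.
have Bint x (m : int) : B x m%:~R = 1.
  case: (intP m) => [|n|n]; first by rewrite BC B0.
    by rewrite -[X in B x X]mulr1 Bnat B1 expr1n.
  by rewrite rmorphN BC BN BC -[X in B x X]mulr1 Bnat B1 expr1n invr1.
move=> x y; suff : B x y = 1.
  move=> e; have := divfK (x := h x * h y) _ (h (x + y)).
  by rewrite -/(B x y) e mul1r => <-//; rewrite mulf_neq0.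
have dE : (denq y)%:~R = `|denq y|%:R :> rat by rewrite -[in LHS](gez0_abs (denq_ge0 y)).
have dn0 : (denq y)%:~R != 0 :> rat by rewrite intr_eq0 denq_neq0.
(* With [d] the denominator of [y], [B x y = B x' y ^+ d = B x' (d * y)], and [d * y] is the
   numerator of [y]. *)
pose x' := x / (denq y)%:~R.
have -> : x = (denq y)%:~R * x' by rewrite mulrC divfK.
by rewrite dE BC Bnat [B y x']BC -Bnat -dE mulrC -numqE Bint.
Qed.

(** * Rigidity of continuous functions on the line *)

Section ComplexValuedContinuity.
Variable R : realType.
Implicit Types f g : R -> R[i].

Definition continuousC f : Prop :=
  continuous (fun t => Re (f t)) /\ continuous (fun t => Im (f t)).

Lemma continuousC_mul f g :
  continuousC f -> continuousC g -> continuousC (fun t => f t * g t).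
Proof.
move=> [rf jf] [rg jg]; split=> t.
  under eq_fun do rewrite Re_mul.
  by apply: cvgB; apply: cvgM; [exact: rf|exact: rg|exact: jf|exact: jg].
under eq_fun do rewrite Im_mul.
by apply: cvgD; apply: cvgM; [exact: rf|exact: jg|exact: jf|exact: rg].
Qed.

Lemma continuousC_scale f (a : R) : continuousC f -> continuousC (fun t => f (a * t)).
Proof.
move=> [rf jf]; have ca : continuous (fun t : R => a * t).
  by move=> t; apply: cvgM; [exact: cvg_cst | exact: cvg_id].
split=> t.
  by apply: (continuous_comp (g := fun s => Re (f s))); [exact: ca | exact: rf].
by apply: (continuous_comp (g := fun s => Im (f s))); [exact: ca | exact: jf].
Qed.

Lemma continuousC_div f g : (forall t, g t != 0) ->
  continuousC f -> continuousC g -> continuousC (fun t => f t / g t).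
Proof.
move=> g0 cf [rg jg]; apply: continuousC_mul => //.
have sg t : (fun t => sqn (g t)) @ t --> sqn (g t).
  rewrite /sqn; under eq_fun do rewrite !expr2; rewrite !expr2.
  by apply: cvgD; apply: cvgM; (exact: rg || exact: jg).
have sV t : (fun t => (sqn (g t))^-1) @ t --> (sqn (g t))^-1.
  by apply: cvgV; [rewrite sqn_eq0; exact: g0 | exact: sg].
have ReV z : Re z^-1 = Re z * (sqn z)^-1 :> R by case: z.
have ImV z : Im z^-1 = - (Im z * (sqn z)^-1) :> R by case: z.
split=> t.
  under eq_fun do rewrite ReV.
  by apply: cvgM; [exact: rg | exact: sV].
under eq_fun do rewrite ImV.
by apply: cvgN; apply: cvgM; [exact: jg | exact: sV].
Qed.

(** Using the relation twice gives [k (a ^+ 2 * t) = k t]; iterating moves the argument to 0, where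
    [k] is 1. *)
Lemma contraction_trivial (k : R -> R[i]) (a : R) : continuousC k -> k 0 = 1 ->
  `|a| < 1 -> (forall t, k t * k (a * t) = 1) -> forall t, k t = 1.
Proof.
move=> [rk jk] k0 a1 ka t.
have k2 s : k (a ^+ 2 * s) = k s.
  have n0 : k (a * s) != 0.
    by apply/eqP => e; have := ka s; rewrite e mulr0 => /esym/eqP; rewrite oner_eq0.
  by apply: (mulIf n0); rewrite ka mulrC expr2 -mulrA ka.
have kn n : k ((a ^+ 2) ^+ n * t) = k t.
  by elim: n => [|n IHn]; [rewrite mul1r | rewrite exprS -mulrA k2].
have at0 : (fun n => (a ^+ 2) ^+ n * t) @ \oo --> (0 : R).
  rewrite -[X in _ --> X](mul0r t); apply: cvgM; last exact: cvg_cst.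
  by apply: cvg_expr; rewrite normrX expr_lt1.
have lim (f : R -> R) : continuous f -> (forall n, f ((a ^+ 2) ^+ n * t) = f t) -> f t = f 0.
  move=> cf fE; have c := cvg_comp _ _ at0 (cf 0).
  apply: (cvg_unique _ _ c) => //; apply: cvg_near_cst; apply: nearW => n.
  exact: fE.
by rewrite -k0; apply: complex_ext;
  [apply: (lim (fun s => Re (k s))) | apply: (lim (fun s => Im (k s)))] => // n; rewrite kn.
Qed.

(** The values are 1 or -1, and a change of sign between 0 and [t] would force the real part to
    vanish in between. *)
Lemma square_trivial (k : R -> R[i]) : continuousC k -> k 0 = 1 ->
  (forall t, k t * k t = 1) -> forall t, k t = 1.
Proof.
move=> [rk _] k0 kk t.
have kpm s : k s = 1 \/ k s = -1.
  by have /eqP := kk s; rewrite -expr2 sqrf_eq1 => /orP[] /eqP; [left|right].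
have [//|kt] := kpm t; exfalso.
pose f s := Re (k (t * s)).
have cf : continuous f.
  (* The real part is put into both components so that the scaling lemma applies to it. *)
  exact: (continuousC_scale t
    (conj rk rk : continuousC (fun s => Re (k s) +i* Re (k s)))).1.
have [c _ fc] : exists2 c, c \in `[0, 1]%R & f c = 0.
  apply: IVT; first exact: ler01.
    exact: continuous_subspaceT.
  by rewrite /f mulr0 mulr1 k0 kt /=; rewrite ge_min le_max oppr_le0 !ler01 !orbT.
move: fc; rewrite /f; case: (kpm (t * c)) => -> /=; first by move/eqP; rewrite oner_eq0.
by move/eqP; rewrite oppr_eq0 oner_eq0.
Qed.

(** The right-hand side is [phi (mu * t)] for the homomorphism [phi] below. The quotient [k] of [h]
    by it satisfies [k s * k (lam * s) = 1], since [mu * (1 + lam) = 1], and is therefore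
    trivial. *)
Lemma dilation_hom (h : R -> R[i]) (lam : R) : continuousC h -> h 0 = 1 ->
  (forall s t, h (s + t) * h (lam * (s + t)) =
               (h s * h (lam * s)) * (h t * h (lam * t))) ->
  lam != 0 -> `|lam| != 1 \/ lam = 1 ->
  forall t, h t = h ((1 + lam)^-1 * t) * h (lam * ((1 + lam)^-1 * t)).
Proof.
move=> ch h0 hD lam0 lam1 t.
pose mu := (1 + lam)^-1.
have lamN1 : 1 + lam != 0.
  case: lam1 => [|->]; last by rewrite -[1 + 1]/(2%:R) pnatr_eq0.
  by apply: contra_neq => /eqP; rewrite addrC addr_eq0 => /eqP ->; rewrite normrN1.
pose phi s := h s * h (lam * s).
have phiD s r : phi (s + r) = phi s * phi r by exact: hD.
have phi0 : phi 0 = 1 by rewrite /phi mulr0 h0 mulr1.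
pose k s := h s * phi (- mu * s).
have ck : continuousC k.
  apply: continuousC_mul => //; apply: (continuousC_scale (f := phi)).
  by apply: continuousC_mul => //; exact: continuousC_scale.
have k0 : k 0 = 1 by rewrite /k mulr0 phi0 h0 mulr1.
have klam s : k s * k (lam * s) = 1.
  rewrite /k mulrACA -/(phi s) -!phiD -phi0; congr phi.
  by rewrite /mu; field.
have k1 s : k s = 1.
  case: lam1 => [|l1]; last first.
    by apply: square_trivial => // r; have := klam r; rewrite l1 mul1r.
  rewrite neq_lt => /orP[l1|l1]; first exact: (contraction_trivial ck k0 l1).
  (* For [|lam| > 1] the relation is read at [lam^-1 * r], which makes [lam^-1] the contraction
     factor. *)
  apply: (contraction_trivial (a := lam^-1) ck k0); first by rewrite normfV invf_lt1// (lt_trans ltr01).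
  by move=> r; have := klam (lam^-1 * r); rewrite mulVKf// mulrC.
have := k1 t; rewrite /k => e.
have pn : phi (mu * t) * phi (- mu * t) = 1 by rewrite -phiD mulNr subrr.
by rewrite -/(phi _) -[LHS]mulr1 -pn mulrCA e mulr1.
Qed.

End ComplexValuedContinuity.

(** * Ratios of characteristic functions *)

Section Quotient.
Context d (T : measurableType d) d' (T' : measurableType d') (R : realType).
Variables (P : probability T R) (P' : probability T' R).

Definition charf_ratio (X : T -> rat) (Y : T' -> rat) (t : R) : R[i] :=
  charf P' Y t / charf P X t.

Section OnePair.
Variables (X : T -> rat) (Y : T' -> rat).
Hypotheses (mX : rat_rv X) (mY : rat_rv Y).
Hypotheses (nX : charfun_nonvanishing P X) (nY : charfun_nonvanishing P' Y).

Lemma charf_ratio0 : charf_ratio X Y 0 = 1.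
Proof. by rewrite /charf_ratio !charf_at0 divff ?oner_neq0. Qed.

Lemma charf_ratio_neq0 t : charf_ratio X Y t != 0.
Proof. by rewrite mulf_neq0 ?invr_neq0 ?charf_neq0. Qed.

Lemma charf_ratioN t : charf_ratio X Y (- t) = (charf_ratio X Y t)^*%C.
Proof. by rewrite /charf_ratio !charfN// rmorphM fmorphV. Qed.

Lemma charf_ratio_continuous : continuousC (charf_ratio X Y).
Proof.
apply: continuousC_div => [t||]; first exact: charf_neq0.
  exact: charf_continuous.
exact: charf_continuous.
Qed.

Lemma sqn_charf_ratio_cvg (x : R) :
  (fun n => sqn (charf_ratio X Y (x + n`!%:R))) @ \oo --> sqn (charf_ratio X Y x).
Proof.
have sc dS (S : measurableType dS) (Q : probability S R) (Z : S -> rat) : rat_rv Z ->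
    (fun n => sqn (charf Q Z (x + n`!%:R))) @ \oo --> sqn (charf Q Z x).
  move=> mZ; have [cR cI] := charf_fact_cvg Q x mZ.
  by rewrite /sqn; apply: cvgD; rewrite expr2; under eq_fun do rewrite expr2; apply: cvgM.
rewrite /charf_ratio sqn_div; under eq_fun do rewrite sqn_div.
apply: cvgM; first exact: sc.
by apply: cvgV; [rewrite sqn_eq0; exact: charf_neq0 | exact: sc].
Qed.

(** The ratio at [- q] is the conjugate of the ratio at [q], so additivity makes its restriction to
    the rationals unitary. *)
Lemma shift_of_ratio :
  (forall q r : rat, charf_ratio X Y (ratr (q + r)) =
     charf_ratio X Y (ratr q) * charf_ratio X Y (ratr r)) ->
  exists al : rat, same_law P' Y P (fun w => X w + al).
Proof.
move=> hD; apply: (shift_of_charf mX mY (h := fun q => charf_ratio X Y (ratr q))).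
  by split=> // q; rewrite -charf_ratioN -rmorphN -hD subrr rmorph0 charf_ratio0.
by move=> q; rewrite divfK// charf_neq0.
Qed.

End OnePair.

(** The joint characteristic functions of both pairs factor by independence and agree; their
    quotient is the product of the ratios. *)
Lemma charf_ratio_equation (a2 a3 b2 b3 : rat)
  (X1 X2 X3 X4 : T -> rat) (Y1 Y2 Y3 Y4 : T' -> rat) :
  rat_rv X1 -> rat_rv X2 -> rat_rv X3 -> rat_rv X4 -> indep4 P X1 X2 X3 X4 ->
  charfun_nonvanishing P X1 -> charfun_nonvanishing P X2 ->
  charfun_nonvanishing P X3 -> charfun_nonvanishing P X4 ->
  rat_rv Y1 -> rat_rv Y2 -> rat_rv Y3 -> rat_rv Y4 -> indep4 P' Y1 Y2 Y3 Y4 ->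
  same_law2 P' (fun w => Y1 w + a2 * Y2 w + a3 * Y3 w)
               (fun w => b2 * Y2 w + b3 * Y3 w + Y4 w)
            P (fun w => X1 w + a2 * X2 w + a3 * X3 w)
              (fun w => b2 * X2 w + b3 * X3 w + X4 w) ->
  forall u v : R, charf_ratio X1 Y1 u *
    charf_ratio X2 Y2 (ratr a2 * u + ratr b2 * v) *
    charf_ratio X3 Y3 (ratr a3 * u + ratr b3 * v) * charf_ratio X4 Y4 v = 1.
Proof.
move=> m1 m2 m3 m4 ind n1 n2 n3 n4 k1 k2 k3 k4 ind' law u v.
have e := expC_same_law2 (rat_rvD (rat_rvD k1 (rat_rvZ a2 k2)) (rat_rvZ a3 k3))
  (rat_rvD (rat_rvD (rat_rvZ b2 k2) (rat_rvZ b3 k3)) k4)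
  (rat_rvD (rat_rvD m1 (rat_rvZ a2 m2)) (rat_rvZ a3 m3))
  (rat_rvD (rat_rvD (rat_rvZ b2 m2) (rat_rvZ b3 m3)) m4)
  law (e2pi_ratr_bound u) (e2pi_ratr_bound v).
rewrite !charf_linear_forms// in e.
rewrite /charf_ratio !mulf_div e divff//.
by rewrite !mulf_neq0 ?charf_neq0.
Qed.

End Quotient.

(** * Recovery up to shifts for independent and for proportional columns of coefficients *)

Theorem theorem4p3 (R : realType) (a2 a3 b2 b3 : rat)
  (d : measure_display) (T : measurableType d) (P : probability T R)
  (xi1 xi2 xi3 xi4 : T -> rat) :
  a2 != 0 -> a3 != 0 -> b2 != 0 -> b3 != 0 ->
  rat_rv xi1 -> rat_rv xi2 -> rat_rv xi3 -> rat_rv xi4 ->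
  indep4 P xi1 xi2 xi3 xi4 ->
  charfun_nonvanishing P xi1 -> charfun_nonvanishing P xi2 ->
  charfun_nonvanishing P xi3 -> charfun_nonvanishing P xi4 ->
  let L1 := fun w => xi1 w + a2 * xi2 w + a3 * xi3 w in
  let L2 := fun w => b2 * xi2 w + b3 * xi3 w + xi4 w in
  (* (I) *)
  (a2 * b3 != a3 * b2 ->
    forall (d' : measure_display) (T' : measurableType d')
      (P' : probability T' R) (eta1 eta2 eta3 eta4 : T' -> rat),
    rat_rv eta1 -> rat_rv eta2 -> rat_rv eta3 -> rat_rv eta4 ->
    indep4 P' eta1 eta2 eta3 eta4 ->
    charfun_nonvanishing P' eta1 -> charfun_nonvanishing P' eta2 ->
    charfun_nonvanishing P' eta3 -> charfun_nonvanishing P' eta4 ->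
    let M1 := fun w => eta1 w + a2 * eta2 w + a3 * eta3 w in
    let M2 := fun w => b2 * eta2 w + b3 * eta3 w + eta4 w in
    same_law2 P' M1 M2 P L1 L2 ->
    exists al1 al2 al3 al4 : rat,
      [/\ same_law P' eta1 P (fun w => xi1 w + al1),
          same_law P' eta2 P (fun w => xi2 w + al2),
          same_law P' eta3 P (fun w => xi3 w + al3) &
          same_law P' eta4 P (fun w => xi4 w + al4)])
  /\
  (* (II)/(III) *)
  (a2 * b3 = a3 * b2 -> same_law P xi2 P xi3 ->
    (`|a2| != `|a3| \/ a2 = a3) ->
    forall (d' : measure_display) (T' : measurableType d')
      (P' : probability T' R) (eta1 eta2 eta3 eta4 : T' -> rat),
    rat_rv eta1 -> rat_rv eta2 -> rat_rv eta3 -> rat_rv eta4 ->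
    indep4 P' eta1 eta2 eta3 eta4 ->
    charfun_nonvanishing P' eta1 -> charfun_nonvanishing P' eta2 ->
    charfun_nonvanishing P' eta3 -> charfun_nonvanishing P' eta4 ->
    same_law P' eta2 P' eta3 ->
    let M1 := fun w => eta1 w + a2 * eta2 w + a3 * eta3 w in
    let M2 := fun w => b2 * eta2 w + b3 * eta3 w + eta4 w in
    same_law2 P' M1 M2 P L1 L2 ->
    exists al1 al2 al3 al4 : rat,
      [/\ same_law P' eta1 P (fun w => xi1 w + al1),
          same_law P' eta2 P (fun w => xi2 w + al2),
          same_law P' eta3 P (fun w => xi3 w + al3) &
          same_law P' eta4 P (fun w => xi4 w + al4)]).
Proof.
move=> a20 a30 b20 b30 m1 m2 m3 m4 ind n1 n2 n3 n4 L1 L2; split.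
  move=> ab d' T' P' eta1 eta2 eta3 eta4 k1 k2 k3 k4 ind' o1 o2 o3 o4 M1 M2 law.
  have E := charf_ratio_equation m1 m2 m3 m4 ind n1 n2 n3 n4 k1 k2 k3 k4 ind' law.
  pose h1 q := charf_ratio P P' xi1 eta1 (ratr q).
  pose h2 q := charf_ratio P P' xi2 eta2 (ratr q).
  pose h3 q := charf_ratio P P' xi3 eta3 (ratr q).
  pose h4 q := charf_ratio P P' xi4 eta4 (ratr q).
  have EQ u v : h1 u * h2 (a2 * u + b2 * v) * h3 (a3 * u + b3 * v) * h4 v = 1.
    by have := E (ratr u) (ratr v); rewrite -!rmorphM -!rmorphD.
  have z1 q : h1 q != 0 by exact: charf_ratio_neq0.
  have z2 q : h2 q != 0 by exact: charf_ratio_neq0.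
  have z3 q : h3 q != 0 by exact: charf_ratio_neq0.
  have z4 q : h4 q != 0 by exact: charf_ratio_neq0.
  have shift (X : T -> rat) (Y : T' -> rat) (h := fun q : rat => charf_ratio P P' X Y (ratr q)) :
      rat_rv X -> rat_rv Y -> charfun_nonvanishing P X -> charfun_nonvanishing P' Y ->
      (forall x y z, h (x + y + z) * h x * h y * h z =
                     h (x + y) * h (x + z) * h (y + z) * h 0) ->
      exists al : rat, same_law P' Y P (fun w => X w + al).
    move=> mX mY nX nY h3d; apply: shift_of_ratio => // q r.
    apply: (quadratic_hom (h := h)) => // [x||x|x].
    - exact: charf_ratio_neq0.
    - by rewrite /h rmorph0 charf_ratio0.
    - by rewrite /h rmorphN charf_ratioN.
    - rewrite /h; under eq_fun do rewrite rmorphD /= ratr_nat.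
      exact: sqn_charf_ratio_cvg.
  have ab' : a2 * b3 - b2 * a3 != 0 by rewrite subr_eq0 [b2 * a3]mulrC.
  (* Each form is distinguished in turn. Up to sign, the determinants that arise are 1, the
     coefficients [a2], [a3], [b2], [b3], and [a2 * b3 - b2 * a3], all nonzero. *)
  have [al1 law1] : exists al : rat, same_law P' eta1 P (fun w => xi1 w + al).
    apply: shift => //; apply: (third_difference (h1 := h1) (p1 := 1) (q1 := 0)
      (p2 := a2) (q2 := b2) (p3 := a3) (q3 := b3) (p4 := 0) (q4 := 1) z1 z2 z3 z4).
    1-3: by rewrite !(mul1r, mul0r, mulr1, subr0).
    by move=> u v; rewrite -[RHS](EQ u v) !(mul1r, mul0r, add0r, addr0).
  have [al2 law2] : exists al : rat, same_law P' eta2 P (fun w => xi2 w + al).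
    apply: shift => //; apply: (third_difference (h1 := h2) (p1 := a2) (q1 := b2)
      (p2 := 1) (q2 := 0) (p3 := a3) (q3 := b3) (p4 := 0) (q4 := 1) z2 z1 z3 z4).
    1-3: by rewrite ?(mulr1, mulr0, subr0, sub0r) ?oppr_eq0.
    by move=> u v; rewrite -[RHS](EQ u v) !(mul1r, mul0r, add0r, addr0) [h2 _ * _]mulrC.
  have [al3 law3] : exists al : rat, same_law P' eta3 P (fun w => xi3 w + al).
    apply: shift => //; apply: (third_difference (h1 := h3) (p1 := a3) (q1 := b3)
      (p2 := 1) (q2 := 0) (p3 := a2) (q3 := b2) (p4 := 0) (q4 := 1) z3 z1 z2 z4).
    1,3: by rewrite ?(mulr1, mulr0, subr0, sub0r) ?oppr_eq0.
      by rewrite -oppr_eq0 opprB [b3 * a2]mulrC [a3 * b2]mulrC.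
    move=> u v; rewrite -[RHS](EQ u v) !(mul1r, mul0r, add0r, addr0).
    by congr (_ * _); rewrite -mulrA mulrC.
  have [al4 law4] : exists al : rat, same_law P' eta4 P (fun w => xi4 w + al).
    apply: shift => //; apply: (third_difference (h1 := h4) (p1 := 0) (q1 := 1)
      (p2 := 1) (q2 := 0) (p3 := a2) (q3 := b2) (p4 := a3) (q4 := b3) z4 z1 z2 z3).
    1-3: by rewrite !(mul1r, mul0r, sub0r, mulr1) oppr_eq0 ?oner_eq0.
    move=> u v; rewrite -[RHS](EQ u v) !(mul1r, mul0r, add0r, addr0).
    by ring.
  by exists al1, al2, al3, al4.
move=> ab law23 a23 d' T' P' eta1 eta2 eta3 eta4 k1 k2 k3 k4 ind' o1 o2 o3 o4 law23' M1 M2 law.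
have E := charf_ratio_equation m1 m2 m3 m4 ind n1 n2 n3 n4 k1 k2 k3 k4 ind' law.
pose h1 := charf_ratio P P' xi1 eta1.
pose h2 := charf_ratio P P' xi2 eta2.
pose h4 := charf_ratio P P' xi4 eta4.
have h32 t : charf_ratio P P' xi3 eta3 t = h2 t.
  rewrite /h2 /charf_ratio (charf_same_law t m2 m3 law23).
  by rewrite (charf_same_law t k2 k3 law23').
pose lam : R := ratr (a3 / a2).
have a2n : ratr a2 != 0 :> R by rewrite fmorph_eq0.
have b2n : ratr b2 != 0 :> R by rewrite fmorph_eq0.
have a3E : ratr a3 = lam * ratr a2 :> R by rewrite -rmorphM divfK.
have b3E : ratr b3 = lam * ratr b2 :> R.
  by rewrite -rmorphM; congr ratr; apply: (mulfI a20); rewrite ab; field.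
(* By proportionality and [h32], the two middle factors merge into [phi] of the single form
   [a2 u + b2 v]. *)
pose phi t := h2 t * h2 (lam * t).
have h10 : h1 0 = 1 by exact: charf_ratio0.
have h20 : h2 0 = 1 by exact: charf_ratio0.
have h40 : h4 0 = 1 by exact: charf_ratio0.
have phi0 : phi 0 = 1 by rewrite /phi mulr0 h20 mulr1.
have Ephi u v : h1 u * phi (ratr a2 * u + ratr b2 * v) * h4 v = 1.
  have lE : lam * (ratr a2 * u + ratr b2 * v) = ratr a3 * u + ratr b3 * v.
    by rewrite a3E b3E; ring.
  by rewrite -(E u v) h32 /phi lE mulrA.
have phin0 t : phi t != 0 by rewrite mulf_neq0// charf_ratio_neq0.
have h1E u : h1 u = (phi (ratr a2 * u))^-1.
  have := Ephi u 0; rewrite mulr0 addr0 h40 mulr1 => e.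
  by apply: (mulIf (phin0 (ratr a2 * u))); rewrite e mulVf.
have h4E v : h4 v = (phi (ratr b2 * v))^-1.
  have := Ephi 0 v; rewrite mulr0 add0r h10 mul1r mulrC => e.
  by apply: (mulIf (phin0 (ratr b2 * v))); rewrite e mulVf.
(* Setting [v = 0] or [u = 0] expressed [h1] and [h4] through [phi]; substituted back at
   [u = s / a2], [v = t / b2], they leave Cauchy's equation. *)
have phiD s t : phi (s + t) = phi s * phi t.
  have := Ephi (s / ratr a2) (t / ratr b2); rewrite h1E h4E.
  rewrite ![ratr _ * (_ / _)]mulrC !divfK// => e.
  by rewrite -[RHS]mul1r -e; field; rewrite !phin0.
have lam0 : lam != 0 by rewrite fmorph_eq0 mulf_neq0 ?invr_neq0.
have lam1 : `|lam| != 1 \/ lam = 1.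
  case: a23 => [a23|e]; last by right; rewrite /lam e divff ?rmorph1.
  left; rewrite /lam -ratr_norm -(rmorph1 (@ratr R)) (inj_eq (fmorph_inj _)).
  rewrite normf_div; apply: contra_neq a23 => e.
  by rewrite -[LHS]mul1r -e divfK ?normr_eq0.
have ch2 : continuousC h2 by exact: charf_ratio_continuous.
have h2E t : h2 t = phi ((1 + lam)^-1 * t) := dilation_hom ch2 h20 phiD lam0 lam1 t.
have h2D s t : h2 (s + t) = h2 s * h2 t.
  by rewrite (h2E (s + t)) (h2E s) (h2E t) mulrDr phiD.
have [al1 law1] : exists al : rat, same_law P' eta1 P (fun w => xi1 w + al).
  apply: shift_of_ratio => // q r; rewrite -/h1 !h1E rmorphD mulrDr phiD.
  by rewrite invfM.
have [al2 law2] : exists al : rat, same_law P' eta2 P (fun w => xi2 w + al).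
  by apply: shift_of_ratio => // q r; rewrite -/h2 rmorphD h2D.
have [al3 law3] : exists al : rat, same_law P' eta3 P (fun w => xi3 w + al).
  by apply: shift_of_ratio => // q r; rewrite !h32 rmorphD h2D.
have [al4 law4] : exists al : rat, same_law P' eta4 P (fun w => xi4 w + al).
  apply: shift_of_ratio => // q r; rewrite -/h4 !h4E rmorphD mulrDr phiD.
  by rewrite invfM.
by exists al1, al2, al3, al4.
Qed.
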